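(* Let $\Omega$ be a hyperfinite set and let $P\colon {}^{\ast}\mathcal{P}(\Omega)\to{}^{\ast}\mathbb{R}$ be an internal probability measure such that $P(\{\omega\})\approx 0$ for all $\omega\in\Omega$. Let $\alpha\in{}^{\ast}\mathbb{R}$ be positive and finite, and define $P_\alpha\colon {}^{\ast}\mathcal{P}(\Omega)\to{}^{\ast}\mathbb{R}$ by $$P_\alpha(A)=\mathrm{St}(P(A))+\alpha\,\bigl(P(A)-\mathrm{St}(P(A))\bigr).$$ If $\alpha\neq 1$, then $P_\alpha$ is external.
   Context: We work in Robinson's framework for nonstandard analysis: ${}^{\ast}\mathbb{R}$ is a hyperreal field, i.e. the (proper) nonstandard extension of $\mathbb{R}$ in a nonstandard universe satisfying the transfer principle. A set or function is internal if it is an element of the $\ast$-extension of some classical (standard) set, and external otherwise. A hyperfinite set is an internal set that is in internal bijection with $\{1,\dots,N\}$ for some $N\in{}^{\ast}\mathbb{N}$. For a hyperfinite set $\Omega$, ${}^{\ast}\mathcal{P}(\Omega)$ is the set of all internal subsets of $\Omega$. An internal probability measure on $\Omega$ is an internal function $P\colon{}^{\ast}\mathcal{P}(\Omega)\to{}^{\ast}\mathbb{R}$ with $P(A)\ge 0$ for all $A$, $P(\Omega)=1$, and $P(A\cup B)=P(A)+P(B)$ for disjoint $A,B\in{}^{\ast}\mathcal{P}(\Omega)$. The relation $x\approx y$ means that $x-y$ is infinitesimal. An element of ${}^{\ast}\mathbb{R}$ is finite if its absolute value is bounded by a standard real number. For finite $x\in{}^{\ast}\mathbb{R}$, the standard part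 $\mathrm{St}(x)$ is the unique real number infinitely close to $x$. *)

(* Defs.v *)
From mathcomp Require Import all_boot all_order all_algebra.
From mathcomp Require Import boolp classical_sets functions reals.

Set Implicit Arguments.
Unset Strict Implicit.
Unset Printing Implicit Defensive.

Import Order.TTheory GRing.Theory Num.Theory.
Local Open Scope classical_set_scope.
Local Open Scope ring_scope.

(* The ranks V_0(S) = S and V_{n+1}(S) = V_n(S) `|` P(V_n(S)), as classes in a
   membership structure on T whose urelements are given by atom. *)
Fixpoint rank (S T : Type) (atom : S -> T) (vin : T -> T -> Prop) (n : nat) :
    set T :=
  match n with
  | 0 => range atom
  | n'.+1 => rank atom vin n' `|`
      [set x | ~ range atom x /\ forall y, vin y x -> rank atom vin n' y]
  end.

(* The superstructure V(S) = \bigcup_n V_n(S), which these axioms characterize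
   up to isomorphism. The value of setof A is meaningful only when A is included
   in some rank; it is then the element of V(S) whose members are those of A. *)
Record superstructure (S : Type) := Superstructure {
  entity :> Type;
  atom : S -> entity;
  vin : entity -> entity -> Prop;
  setof : set entity -> entity;
  atom_inj : injective atom;
  vin_atom : forall s x, ~ vin x (atom s);
  vin_ext : forall x y, ~ range atom x -> ~ range atom y ->
    (forall z, vin z x <-> vin z y) -> x = y;
  rank_exhaust : forall x, exists n, rank atom vin n x;
  setof_not_atom : forall n A, A `<=` rank atom vin n ->
    ~ range atom (setof A);
  vin_setof : forall n A, A `<=` rank atom vin n ->
    forall z, vin z (setof A) <-> A z
}.

Section Sets.
Variables (S : Type) (V : superstructure S).
Implicit Types (x y : V) (A : set V).

Definition is_set x : Prop := ~ range (@atom S V) x.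
Definition ext x : set V := [set z | vin z x].
Definition sing x : V := setof [set x].
Definition vunion x y : V := setof (ext x `|` ext y).
Definition opair x y : V := setof [set sing x; setof [set x; y]].

(* Graphs, as elements of V(S), of a function with domain A, and of a binary
   operation and a binary relation on a type T placed in V(S) by i. *)
Definition graph A (F : V -> V) : V := setof [set opair x (F x) | x in A].
Definition op_graph (T : Type) (i : T -> V) (op : T -> T -> T) : V :=
  setof [set z | exists a b, z = opair (opair (i a) (i b)) (i (op a b))].
Definition rel_graph (T : Type) (i : T -> V) (r : T -> T -> Prop) : V :=
  setof [set z | exists a b, r a b /\ z = opair (i a) (i b)].

End Sets.

(* Formulas of the language of set theory with bounded quantifiers only:
   BAll i j f and BEx i j f stand for "for all (resp. some) v_i in v_j, f". *)
Inductive bformula :=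
| BEq of nat & nat
| BIn of nat & nat
| BNot of bformula
| BAnd of bformula & bformula
| BOr of bformula & bformula
| BImp of bformula & bformula
| BAll of nat & nat & bformula
| BEx of nat & nat & bformula.

Definition upd (T : Type) (e : nat -> T) (i : nat) (x : T) : nat -> T :=
  fun j => if j == i then x else e j.

Fixpoint sat (S : Type) (V : superstructure S) (e : nat -> V) (f : bformula) :
    Prop :=
  match f with
  | BEq i j => e i = e j
  | BIn i j => vin (e i) (e j)
  | BNot g => ~ sat e g
  | BAnd g h => sat e g /\ sat e h
  | BOr g h => sat e g \/ sat e h
  | BImp g h => sat e g -> sat e h
  | BAll i j g => forall x, vin x (e j) -> sat (upd e i x) g
  | BEx i j g => exists2 x, vin x (e j) & sat (upd e i x) g
  end.

(* The base set of urelements may be larger than the set of reals. The field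
   hyperreal is the ordered field *R: the axioms star_reals, star_add, star_mul
   and star_le say that its carrier, operations and order, placed in V(ns_base)
   by hyp, are the *-images of those of R, placed in V(std_base) by real. *)
Record nonstandard_universe (R : realType) := NonstandardUniverse {
  std_base : Type;
  ns_base : Type;
  stdV : superstructure std_base;
  nsV : superstructure ns_base;
  star : stdV -> nsV;
  star_base : star (setof (range (@atom _ stdV))) = setof (range (@atom _ nsV));
  transfer : forall (f : bformula) (e : nat -> stdV),
    sat e f <-> sat (star \o e) f;
  real_base : R -> std_base;
  real_base_inj : injective real_base;
  hyperreal : realFieldType;
  hyp_base : hyperreal -> ns_base;
  hyp_base_inj : injective hyp_base;
  std : R -> hyperreal;
  real := (fun r => atom stdV (real_base r));
  hyp := (fun x => atom nsV (hyp_base x));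
  star_real : forall r, star (real r) = hyp (std r);
  star_reals : star (setof (range real)) = setof (range hyp);
  star_add : star (op_graph real +%R) = op_graph hyp +%R;
  star_mul : star (op_graph real *%R) = op_graph hyp *%R;
  star_le : star (rel_graph real (fun a b => a <= b)) =
            rel_graph hyp (fun a b => a <= b);
  star_proper : exists x, ~ range std x
}.

Section Nonstandard.
Variables (R : realType) (U : nonstandard_universe R).
Implicit Types (x y : hyperreal U) (Omega A B : nsV U).

Definition infinitesimal x : Prop := forall r : R, 0 < r -> `|x| < std U r.
Definition infclose x y : Prop := infinitesimal (x - y).
Definition limited x : Prop := exists r : R, `|x| <= std U r.

(* Junk value 0 when x is not limited. *)
Definition St x : R := xget 0 [set r | infclose x (std U r)].

Definition internal (v : nsV U) : Prop := exists a : stdV U, vin v (star a).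

Definition internal_fun (D : set (nsV U)) (F : nsV U -> nsV U) : Prop :=
  internal (graph D F).

Definition hypernat : set (hyperreal U) :=
  [set x | vin (hyp x) (star (setof (range (fun n : nat => real U n%:R))))].

Definition hyperfinite Omega : Prop :=
  [/\ is_set Omega, internal Omega &
    exists (N : hyperreal U) (F : nsV U -> nsV U),
      [/\ hypernat N,
          set_bij (ext Omega)
            [set hyp k | k in [set k | hypernat k /\ 1 <= k <= N]] F &
          internal_fun (ext Omega) F]].

Definition ipowerset Omega : set (nsV U) :=
  [set A | [/\ is_set A, internal A & ext A `<=` ext Omega]].

(* A map with domain ipowerset Omega and values in *R is represented by a total
   map nsV U -> hyperreal U, of which only the values on ipowerset Omega
   matter. *)
Definition internal_on Omega (P : nsV U -> hyperreal U) : Prop :=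
  internal_fun (ipowerset Omega) (fun A => hyp (P A)).

Definition external_on Omega (P : nsV U -> hyperreal U) : Prop :=
  ~ internal_on Omega P.

Definition internal_probability Omega (P : nsV U -> hyperreal U) : Prop :=
  [/\ internal_on Omega P,
      forall A, ipowerset Omega A -> 0 <= P A,
      P Omega = 1 &
      forall A B, ipowerset Omega A -> ipowerset Omega B ->
        ext A `&` ext B = set0 -> P (vunion A B) = P A + P B].

Definition P_alpha (P : nsV U -> hyperreal U) (alpha : hyperreal U) A :
    hyperreal U :=
  std U (St (P A)) + alpha * (P A - std U (St (P A))).

End Nonstandard.

(* Main.v *)
(* Put G = P_alpha. As alpha <> 1, the condition "P(A) <= 1 and
   G(A) = alpha P(A)" on A in *P(Omega) says exactly that P(A) is infinitesimal.
   This property passes from the empty set to A `|` {w} for every w in Omega,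
   since points have infinitesimal measure. If G were internal, then the
   condition would be internal, and hyperfinite induction would give
   G(Omega) = alpha P(Omega), that is 1 = alpha. Hyperfinite induction, for this
   condition, is the transfer of one bounded formula in which P, G and an
   injection of the set into an initial segment of N are variables; all
   quantifiers range over the set V_n, for n large enough. *)

Require Import Defs.
From mathcomp Require Import all_boot all_order all_algebra.
From mathcomp Require Import boolp classical_sets functions reals.
From mathcomp Require Import zify lra.
Set Implicit Arguments.
Unset Strict Implicit.
Unset Printing Implicit Defensive.
Import Order.TTheory GRing.Theory Num.Theory.
Local Open Scope ring_scope.
Local Open Scope classical_set_scope.

(** * Ranks, Kuratowski pairs and graphs in a superstructure *)

Section Superstructure.
Context {S : Type} {V : superstructure S}.
Implicit Types (x y z : V) (A : set V).

Local Notation rk := (rank (@atom S V) (@vin S V)).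

Lemma rank_mono m n : (m <= n)%N -> rk m `<=` rk n.
Proof.
move=> /subnK <-; elim: (n - m)%N => [|k IH] //= x /IH; by left.
Qed.

Lemma rank_trans n x y : rk n x -> vin y x -> rk n y.
Proof.
elim: n => [|n IH] /=; first by move=> [s _ <-] yx; case: (vin_atom yx).
by move=> [h yx|[_ h] yx]; left; [exact: IH h yx|exact: h].
Qed.

Lemma rank_atom n s : rk n (atom V s).
Proof. by apply: (@rank_mono 0) => //; exists s. Qed.

Lemma rank_setof n A : A `<=` rk n -> rk n.+1 (setof A).
Proof.
move=> hA; right; split; first exact: setof_not_atom hA.
by move=> y yx; apply: (hA); apply/(vin_setof hA).
Qed.

Lemma is_set_vin x y : vin y x -> is_set x.
Proof. by move=> yx [s _ es]; rewrite -es in yx; case: (vin_atom yx). Qed.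

Lemma rank2 x y : exists n, rk n x /\ rk n y.
Proof.
have [m hm] := rank_exhaust x; have [n hn] := rank_exhaust y.
exists (maxn m n); split; [move: hm|move: hn]; apply: rank_mono.
  exact: leq_maxl.
exact: leq_maxr.
Qed.

Lemma vin_sing x z : vin z (sing x) <-> z = x.
Proof.
have [n hn] := rank_exhaust x.
by apply: (@vin_setof _ _ n) => _ ->.
Qed.

Lemma vin_pair x y z : vin z (setof [set x; y]) <-> z = x \/ z = y.
Proof.
have [n [hx hy]] := rank2 x y.
by apply: (@vin_setof _ _ n) => _ [->|->].
Qed.

Lemma vin_opair x y z :
  vin z (opair x y) <-> z = sing x \/ z = setof [set x; y].
Proof. exact: vin_pair. Qed.

Lemma opair_inj x y x' y' : opair x y = opair x' y' -> x = x' /\ y = y'.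
Proof.
move=> e.
have h z : z = sing x \/ z = setof [set x; y] <->
           z = sing x' \/ z = setof [set x'; y'].
  by rewrite -!vin_opair e.
have xx : x = x'.
  have [/(_ (or_introl erefl)) [] E _] := h (sing x).
    by apply/vin_sing; rewrite -E; apply/vin_sing.
  by symmetry; apply/vin_sing; rewrite E; apply/vin_pair; left.
split=> //; subst x'.
have [/(_ (or_intror erefl)) E1 _] := h (setof [set x; y]).
have [_ /(_ (or_intror erefl)) E2] := h (setof [set x; y']).
have yin w : vin w (setof [set x; w]) by apply/vin_pair; right.
(* Either [{x, y}] is the singleton of [x], so that [y = x] and the other pair must degenerate as
   well, or the two unordered pairs agree. *)
case: E1 => E1.
  have yx : y = x by apply/vin_sing; rewrite -E1.
  case: E2 => E2.
    by rewrite yx; symmetry; apply/vin_sing; rewrite -E2.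
  have := yin y'; rewrite E2 => /vin_pair; rewrite yx; by case.
have := yin y; rewrite E1 => /vin_pair [yx|//].
have := yin y'; rewrite -E1 => /vin_pair [y'x|//]; by rewrite yx y'x.
Qed.

Lemma is_set_sing x : is_set (sing x).
Proof. by apply: (@is_set_vin _ x); apply/vin_sing. Qed.

Lemma opairP x y z : z = opair x y <-> exists2 u, vin u z &
  exists2 w, vin w z & (vin x u /\ forall t, vin t u -> t = x) /\
   ((vin x w /\ (vin y w /\ forall t, vin t w -> t = x \/ t = y)) /\
    forall t, vin t z -> t = u \/ t = w).
Proof.
split=> [->|].
  exists (sing x); first by apply/vin_opair; left.
  exists (setof [set x; y]); first by apply/vin_opair; right.
  split; first by split=> [|t /vin_sing]//; apply/vin_sing.
  split; last by move=> t /vin_opair.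
  split; first by apply/vin_pair; left.
  by split=> [|t /vin_pair]//; apply/vin_pair; right.
move=> [u uz [w wz [[xu hu] [[xw [yw hw]] hz]]]].
have eu : u = sing x.
  apply: vin_ext; [exact: is_set_vin xu|exact: is_set_sing|].
  by move=> t; rewrite vin_sing; split=> [/hu|->].
have ew : w = setof [set x; y].
  apply: vin_ext; [exact: is_set_vin xw| |].
    by apply: (@is_set_vin _ x); apply/vin_pair; left.
  by move=> t; rewrite vin_pair; split=> [/hw//|[->|->]].
apply: vin_ext; first exact: is_set_vin uz.
  by apply: (@is_set_vin _ (sing x)); apply/vin_opair; left.
by move=> t; rewrite vin_opair -eu -ew; split=> [/hz//|[->|->]].
Qed.

Lemma rank_sing n x : rk n x -> rk n.+1 (sing x).
Proof. by move=> hx; apply: rank_setof => _ ->. Qed.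

Lemma rank_opair n x y : rk n x -> rk n y -> rk n.+2 (opair x y).
Proof.
move=> hx hy; apply: rank_setof => z [->|->]; first exact: rank_sing.
by apply: rank_setof => _ [->|->].
Qed.

(** Bounding arguments and values by one rank bounds the pairs two ranks higher, so that [setof] is
    meaningful on the graph. *)
Lemma vin_graph n A (F : V -> V) :
  A `<=` rk n -> (forall x, A x -> rk n (F x)) ->
  forall x y, vin (opair x y) (graph A F) <-> A x /\ y = F x.
Proof.
move=> hA hF x y.
have hs : [set opair x (F x) | x in A] `<=` rk n.+2.
  by move=> _ [u uA <-]; apply: rank_opair; [exact: hA|exact: hF].
rewrite (vin_setof hs); split=> [[u uA /opair_inj[<- <-]]//|[xA ->]].
by exists x.
Qed.

Lemma vin_op_graph (T : Type) (i : T -> S) (op : T -> T -> T) x y z :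
  vin (opair (opair x y) z) (op_graph (fun t => atom V (i t)) op) <->
  exists a b, [/\ x = atom V (i a), y = atom V (i b) & z = atom V (i (op a b))].
Proof.
rewrite (@vin_setof _ _ 4); last first.
  move=> _ [a [b ->]]; apply: rank_opair; last exact: rank_atom.
  by apply: rank_opair; exact: rank_atom.
split=> [[a [b /opair_inj[/opair_inj[-> ->] ->]]]|[a [b [-> -> ->]]]].
  by exists a, b.
by exists a, b.
Qed.

Lemma vin_rel_graph (T : Type) (i : T -> S) (r : T -> T -> Prop) x y :
  vin (opair x y) (rel_graph (fun t => atom V (i t)) r) <->
  exists a b, [/\ x = atom V (i a), y = atom V (i b) & r a b].
Proof.
rewrite (@vin_setof _ _ 2); last first.
  by move=> _ [a [b [_ ->]]]; apply: rank_opair; exact: rank_atom.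
split=> [[a [b [rab /opair_inj[-> ->]]]]|[a [b [-> -> rab]]]].
  by exists a, b.
by exists a, b.
Qed.

Lemma vin_vunion x y z : vin z (vunion x y) <-> vin z x \/ vin z y.
Proof.
have [n [hx hy]] := rank2 x y.
apply: (@vin_setof _ _ n) => t []; exact: rank_trans.
Qed.

Lemma is_set_vunion x y : is_set (vunion x y).
Proof.
have [n [hx hy]] := rank2 x y.
apply: (@setof_not_atom _ _ n) => t []; exact: rank_trans.
Qed.

Definition vempty : V := setof set0.

Lemma vin_vempty x : ~ vin x vempty.
Proof. by rewrite (@vin_setof _ _ 0) => //; exact: sub0set. Qed.

Lemma is_set_vempty : is_set vempty.
Proof. by apply: (@setof_not_atom _ _ 0); exact: sub0set. Qed.

Definition vrank n : V := setof (rk n).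

Lemma vin_vrank n x : vin x (vrank n) <-> rk n x.
Proof. exact: (@vin_setof _ _ n). Qed.

(** * Bounded formulas for membership of pairs and triples in a relation *)

(* The variables 0, ..., 6 are reserved for decoding Kuratowski pairs; every
   other variable of a formula below is at least 7. *)
Definition pairF (x y z : nat) := BEx 0 z (BEx 1 z
  (BAnd (BAnd (BIn x 0) (BAll 2 0 (BEq 2 x)))
  (BAnd (BAnd (BIn x 1) (BAnd (BIn y 1) (BAll 2 1 (BOr (BEq 2 x) (BEq 2 y)))))
        (BAll 2 z (BOr (BEq 2 0) (BEq 2 1)))))).
Definition mem2F (x y f : nat) := BEx 3 f (pairF x y 3).
(** The inner pair is a member of a member of the outer one, so variables 5 and 6 reach it by
    bounded quantifiers. *)
Definition mem3F (x y s m : nat) :=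
  BEx 4 m (BEx 5 4 (BEx 6 5 (BAnd (pairF x y 6) (pairF 6 s 4)))).

Lemma upd_lt (e : nat -> V) (i : nat) x (j : nat) :
  (i < j)%N -> upd e i x j = e j.
Proof. by move=> ij; rewrite /upd gtn_eqF. Qed.

Lemma sat_pairF (e : nat -> V) (x y z : nat) :
  (2 < x)%N -> (2 < y)%N -> (2 < z)%N ->
  sat e (pairF x y z) <-> e z = opair (e x) (e y).
Proof.
move=> hx hy hz; rewrite opairP /=.
by rewrite /upd /= !gtn_eqF// ?(ltn_trans _ hx)// ?(ltn_trans _ hy)//
  ?(ltn_trans _ hz).
Qed.

Lemma sat_mem2F (e : nat -> V) (x y f : nat) :
  (3 < x)%N -> (3 < y)%N -> (3 < f)%N ->
  sat e (mem2F x y f) <-> vin (opair (e x) (e y)) (e f).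
Proof.
move=> hx hy hf.
have h t : sat (upd e 3 t) (pairF x y 3) <-> t = opair (e x) (e y).
  have := @sat_pairF (upd e 3 t) x y 3 (ltnW hx) (ltnW hy) isT.
  by rewrite (upd_lt _ _ hx) (upd_lt _ _ hy).
split=> [[t tf /h<-]//|?]; by exists (opair (e x) (e y)); [|apply/h].
Qed.

Lemma sat_mem3F (e : nat -> V) (x y s m : nat) :
  (6 < x)%N -> (6 < y)%N -> (6 < s)%N -> (6 < m)%N ->
  sat e (mem3F x y s m) <-> vin (opair (opair (e x) (e y)) (e s)) (e m).
Proof.
move=> hx hy hs hm.
have lt i j : (6 < j)%N -> (i <= 6)%N -> (i < j)%N.
  by move=> /[swap] /leq_ltn_trans; apply.
have h u v q : sat (upd (upd (upd e 4 u) 5 v) 6 q)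
    (BAnd (pairF x y 6) (pairF 6 s 4)) <->
    q = opair (e x) (e y) /\ u = opair q (e s).
  set e' := upd _ 6 q.
  have e'E k : (6 < k)%N -> e' k = e k.
    by move=> k6; rewrite /e' !upd_lt //; exact: lt.
  have := @sat_pairF e' x y 6 (lt 2 _ hx isT) (lt 2 _ hy isT) isT.
  have := @sat_pairF e' 6 s 4 isT (lt 2 _ hs isT) isT.
  by rewrite !(e'E _ hx, e'E _ hy, e'E _ hs) => h1 h2; split=> -[/h2 ? /h1 ?].
split=> [[u um [v vu [q qv /h[<- <-]]]]//|hin].
exists (opair (opair (e x) (e y)) (e s)); first by [].
exists (sing (opair (e x) (e y))); first by apply/vin_opair; left.
exists (opair (e x) (e y)); first by apply/vin_sing.
exact/h.
Qed.

End Superstructure.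

(** * Hyperfinite induction as a bounded formula *)

Section InductionFormula.
Context {S : Type} {V : superstructure S}.

(* A is in the domain of p, with p(A) <= one and g(A) = al * p(A), where L and M
   are the graphs of the order and of the multiplication. *)
Definition scaled (W L M one p g al A : V) : Prop :=
  exists2 r, vin r W & exists2 s, vin s W &
    ((vin (opair A r) p /\ vin (opair r one) L) /\
     (vin (opair A s) g /\ vin (opair (opair al r) s) M)).

(* The relation f restricts to an injection of X into {k in N | k <= n}. *)
Definition hyperfinite_induction (W N L M one : V) : Prop :=
  forall X, vin X W -> forall f, vin f W -> forall p, vin p W ->
  forall g, vin g W -> forall n, vin n N -> forall al, vin al W ->
  (forall x, vin x X ->
     exists2 k, vin k N & vin (opair x k) f /\ vin (opair k n) L) ->
  (forall x, vin x X -> forall y, vin y X -> forall k, vin k N ->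
     vin (opair x k) f /\ vin (opair y k) f -> x = y) ->
  (exists2 A, vin A W & scaled W L M one p g al A /\
     (forall t, vin t A -> ~ t = t)) ->
  (forall A, vin A W -> scaled W L M one p g al A -> forall x, vin x X ->
     exists2 B, vin B W & scaled W L M one p g al B /\
       (vin x B /\ ((forall t, vin t A -> vin t B) /\
        (forall t, vin t B -> vin t A \/ t = x)))) ->
  exists2 A, vin A W & scaled W L M one p g al A /\
    ((forall t, vin t A -> vin t X) /\ (forall t, vin t X -> vin t A)).

(* Variables: 7 = W, 8 = N, 9 = L, 10 = M, 11 = one, 12 = X, 13 = f, 14 = p,
   15 = g, 16 = n, 17 = al, 18 = A, 19 = B, 20 = x, 21 = y, 22 = k, 23 = r,
   24 = s, 25 = t. *)
Definition scaledF (A : nat) :=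
  BEx 23 7 (BEx 24 7 (BAnd (BAnd (mem2F A 23 14) (mem2F 23 11 9))
                           (BAnd (mem2F A 24 15) (mem3F 17 23 24 10)))).

Definition hyperfinite_inductionF :=
  BAll 12 7 (BAll 13 7 (BAll 14 7 (BAll 15 7 (BAll 16 8 (BAll 17 7
  (BImp (BAll 20 12 (BEx 22 8 (BAnd (mem2F 20 22 13) (mem2F 22 16 9))))
  (BImp (BAll 20 12 (BAll 21 12 (BAll 22 8
     (BImp (BAnd (mem2F 20 22 13) (mem2F 21 22 13)) (BEq 20 21)))))
  (BImp (BEx 18 7 (BAnd (scaledF 18) (BAll 25 18 (BNot (BEq 25 25)))))
  (BImp (BAll 18 7 (BImp (scaledF 18) (BAll 20 12 (BEx 19 7
     (BAnd (scaledF 19) (BAnd (BIn 20 19) (BAnd (BAll 25 18 (BIn 25 19))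
       (BAll 25 19 (BOr (BIn 25 18) (BEq 25 20))))))))))
  (BEx 18 7 (BAnd (scaledF 18)
     (BAnd (BAll 25 18 (BIn 25 12)) (BAll 25 12 (BIn 25 18)))))))))))))).

Lemma forall_congr (T : Type) (P Q : T -> Prop) :
  (forall x, P x <-> Q x) -> (forall x, P x) <-> (forall x, Q x).
Proof. by move=> h; split=> + x => /(_ x) /h. Qed.

Lemma ex2_congr (T : Type) (P Q Q' : T -> Prop) :
  (forall x, Q x <-> Q' x) ->
  (exists2 x, P x & Q x) <-> (exists2 x, P x & Q' x).
Proof. by move=> h; split=> -[x Px /h]; exists x. Qed.

Lemma imp_congr (P P' Q Q' : Prop) :
  (P <-> P') -> (Q <-> Q') -> (P -> Q) <-> (P' -> Q').
Proof. tauto. Qed.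

Lemma and_congr (P P' Q Q' : Prop) :
  (P <-> P') -> (Q <-> Q') -> (P /\ Q) <-> (P' /\ Q').
Proof. tauto. Qed.

(** A formula and the statement it expresses have the same shape, so their equivalence is reduced
    connective by connective to the atomic parts and the encoded pairs and triples. *)
Ltac sat_congr := repeat first
  [ apply: ex2_congr => ? | exact: sat_mem2F | exact: sat_mem3F
  | exact: iff_refl
  | apply: and_congr | apply: imp_congr | apply: forall_congr => ? ].

(** The range of [A] avoids the variables reserved for pairs and the bound variables 23 and 24. *)
Lemma sat_scaledF (e : nat -> V) A : (6 < A < 23)%N ->
  sat e (scaledF A) <->
  scaled (e 7) (e 9) (e 10) (e 11) (e 14) (e 15) (e 17) (e A).
Proof.
move=> /andP[A6 A23]; apply: ex2_congr => r; apply: ex2_congr => s.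
have AE (e' : nat -> V) : upd (upd e' 23 r) 24 s A = e' A.
  by rewrite /upd !ltn_eqF// (ltn_trans A23).
have A3 : (3 < A)%N by apply: leq_trans A6.
apply: and_congr; apply: and_congr.
- have := @sat_mem2F _ _ (upd (upd e 23 r) 24 s) A 23 14 A3 isT isT.
  by rewrite AE.
- exact: sat_mem2F.
- have := @sat_mem2F _ _ (upd (upd e 23 r) 24 s) A 24 15 A3 isT isT.
  by rewrite AE.
- exact: sat_mem3F.
Qed.

Lemma sat_hyperfinite_inductionF (e : nat -> V) :
  sat e hyperfinite_inductionF <->
  hyperfinite_induction (e 7) (e 8) (e 9) (e 10) (e 11).
Proof.
rewrite /hyperfinite_induction /hyperfinite_inductionF.
sat_congr; exact: sat_scaledF.
Qed.

End InductionFormula.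

(** * Transfer of membership and the embedding of the reals into the hyperreals *)

Section Transfer.
Context {R : realType} {U : nonstandard_universe R}.
Implicit Types (x y z : stdV U) (u v w : nsV U).

(** Gives the entries of [s] to the variables 7, 8, ...; every other variable receives the first
    entry, a value that is never consulted. *)
Local Notation env s := (fun i => nth (nth vempty s 0) s (i - 7)%N).

Lemma star_vin x y : vin x y <-> vin (star x) (star y).
Proof. exact: (@transfer _ U (BIn 7 8) (env [:: x; y])). Qed.

(** Transferring the formula for membership of a pair avoids computing the image of a pair under
    [star]. *)
Lemma star_mem2 x y z :
  vin (opair x y) z <-> vin (opair (star x) (star y)) (star z).
Proof.
have h := @transfer _ U (mem2F 7 8 9) (env [:: x; y; z]).
have h1 := @sat_mem2F _ (stdV U) (env [:: x; y; z]) 7 8 9 isT isT isT.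
have h2 := @sat_mem2F _ (nsV U) (@star R U \o env [:: x; y; z])
  7 8 9 isT isT isT.
exact: iff_trans (iff_sym h1) (iff_trans h h2).
Qed.

Lemma star_mem3 x y z t : vin (opair (opair x y) z) t <->
  vin (opair (opair (star x) (star y)) (star z)) (star t).
Proof.
have h := @transfer _ U (mem3F 7 8 9 10) (env [:: x; y; z; t]).
have h1 := @sat_mem3F _ (stdV U) (env [:: x; y; z; t]) 7 8 9 10 isT isT isT isT.
have h2 := @sat_mem3F _ (nsV U) (@star R U \o env [:: x; y; z; t])
  7 8 9 10 isT isT isT isT.
exact: iff_trans (iff_sym h1) (iff_trans h h2).
Qed.

Lemma real_inj : injective (@real R U).
Proof. by move=> a b e; apply: (@real_base_inj _ U); exact: atom_inj e. Qed.

Lemma hyp_inj : injective (@hyp R U).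
Proof. by move=> a b e; apply: (@hyp_base_inj _ U); exact: atom_inj e. Qed.

(** One triple of the graph of addition is transferred and then decoded in the graph of hyperreal
    addition. *)
Lemma stdD (a b : R) : std U (a + b) = std U a + std U b.
Proof.
have : vin (opair (opair (real U a) (real U b)) (real U (a + b)))
           (op_graph (@real R U) +%R).
  by apply/vin_op_graph; exists a, b.
move/star_mem3; rewrite star_add !star_real => /vin_op_graph[c [d []]].
by move=> /hyp_inj-> /hyp_inj->
  /hyp_inj.
Qed.

Lemma stdM (a b : R) : std U (a * b) = std U a * std U b.
Proof.
have : vin (opair (opair (real U a) (real U b)) (real U (a * b)))
           (op_graph (@real R U) *%R).
  by apply/vin_op_graph; exists a, b.
move/star_mem3; rewrite star_mul !star_real => /vin_op_graph[c [d []]].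
by move=> /hyp_inj-> /hyp_inj->
  /hyp_inj.
Qed.

Lemma std_le (a b : R) : (std U a <= std U b) = (a <= b).
Proof.
have h := star_mem2 (real U a) (real U b)
  (rel_graph (@real R U) (fun a b => a <= b)).
rewrite star_le !star_real in h.
apply/idP/idP => ab.
  have /h/vin_rel_graph : vin (opair (hyp (std U a)) (hyp (std U b)))
      (rel_graph (@hyp R U) (fun a b => a <= b)).
    by apply/vin_rel_graph; exists (std U a), (std U b).
  by move=> [c [d [/real_inj-> /real_inj->]]].
have /h/vin_rel_graph : vin (opair (real U a) (real U b))
    (rel_graph (@real R U) (fun a b => a <= b)).
  by apply/vin_rel_graph; exists a, b.
by move=> [c [d [/hyp_inj-> /hyp_inj->]]].
Qed.

Lemma std_lt (a b : R) : (std U a < std U b) = (a < b).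
Proof. by rewrite !ltNge std_le. Qed.

Lemma std_inj : injective (std U).
Proof. by move=> a b e; apply/eqP; rewrite eq_le -!std_le e lexx. Qed.

Lemma std0 : std U 0 = 0.
Proof. by apply: (@addrI _ (std U 0)); rewrite -stdD !addr0. Qed.

Lemma std1 : std U 1 = 1.
Proof.
have n0 : std U 1 != 0.
  by rewrite -std0; apply/eqP => /std_inj/eqP; rewrite oner_eq0.
by apply: (mulfI n0); rewrite -stdM !mulr1.
Qed.

Lemma stdN (a : R) : std U (- a) = - std U a.
Proof. by apply: (@addrI _ (std U a)); rewrite -stdD !subrr std0. Qed.

Lemma stdB (a b : R) : std U (a - b) = std U a - std U b.
Proof. by rewrite stdD stdN. Qed.

(** * Infinite closeness and the standard part *)

Lemma infclose_std (a b : R) : infclose (std U a) (std U b) -> a = b.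
Proof.
(* The distance of two distinct standard numbers is itself standard and positive, hence is not
   smaller than every standard positive bound. *)
move=> h; apply: contrapT => /eqP ab; have := h `|a - b|.
rewrite normr_gt0 subr_eq0 ab => /(_ isT).
rewrite -stdB ltNge; case/negP.
by case: (ler0P (a - b)) => d; rewrite ?stdN (ler_normr, ler_norm) ?lexx ?orbT.
Qed.

Lemma infinitesimalD (a b : hyperreal U) :
  infinitesimal a -> infinitesimal b -> infinitesimal (a + b).
Proof.
move=> ha hb r r0; have r2 : 0 < r / 2 by rewrite divr_gt0.
rewrite (splitr r) stdD; apply: le_lt_trans (ler_normD _ _) _.
by apply: ltrD; [exact: ha|exact: hb].
Qed.

Lemma infclose_sym (a b : hyperreal U) : infclose a b -> infclose b a.
Proof. by move=> h r /h; rewrite distrC. Qed.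

Lemma infclose_trans (a b c : hyperreal U) :
  infclose a b -> infclose b c -> infclose a c.
Proof.
by move=> ab bc; rewrite /infclose -(subrKA b); exact: infinitesimalD.
Qed.

Lemma St_eq (p : hyperreal U) (r : R) : infclose p (std U r) -> St p = r.
Proof.
move=> pr; have : [set r | infclose p (std U r)] (St p).
  by apply: xgetPex; exists r.
by move=> /infclose_sym h; apply: infclose_std; exact: infclose_trans h pr.
Qed.

(** By completeness of the reals, the supremum of the reals below [p] is infinitely close to [p];
    uniqueness identifies it with [St p]. *)
Lemma St_infclose (p : hyperreal U) (a b : R) :
  std U a <= p -> p <= std U b -> infclose p (std U (St p)).
Proof.
move=> ap pb.
suff [r pr] : exists r, infclose p (std U r) by rewrite (@St_eq p r pr).
pose E := [set r | std U r <= p].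
have supE : has_sup E.
  split; first by exists a.
  by exists b => r /= rp; rewrite -std_le (le_trans rp).
exists (sup E) => e e0.
(* Some [r] in [E] exceeds [sup E - e / 2], which bounds [p] from below, while [sup E + e / 2] is
   not in [E], which bounds [p] from above. *)
have e2 : 0 < e / 2 by rewrite divr_gt0.
have [r rp rE] := sup_adherent e2 supE.
have : std U (sup E) < std U (r + e) by rewrite std_lt; lra.
have {}rp : std U r <= p := rp.
have : p < std U (sup E + e / 2).
  rewrite ltNge; apply/negP => h.
  have hE : E (sup E + e / 2) by [].
  have := ub_le_sup supE.2 hE; lra.
have : std U (sup E + e / 2) < std U (sup E + e) by rewrite std_lt; lra.
rewrite ltr_norml !stdD => h1 h2 h3; apply/andP; split; lra.
Qed.

(** * Internal sets *)

(** Being an atom is membership in rank 0, and [star_base] says that [star] maps the set of all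
    atoms to the set of all atoms. *)
Lemma star_is_set x : is_set x -> is_set (star x).
Proof.
move=> hx sx; apply: hx.
change (rank (@atom _ (stdV U)) (@vin _ (stdV U)) 0 x).
apply/vin_vrank/star_vin; rewrite star_base.
exact/(@vin_vrank _ (nsV U) 0).
Qed.

(** Ranks are transitive, so a set of rank [n] is included in [vrank n], and this inclusion
    transfers. Finitely many internal objects thus share one bound. *)
Lemma internalP v : internal v <-> exists n, vin v (star (vrank n : stdV U)).
Proof.
split=> [[a va]|[n]]; last by exists (vrank n).
have [n an] := rank_exhaust a.
exists n.
have := @transfer _ U (BAll 9 7 (BIn 9 8)) (env [:: a; vrank n]).
move=> -[+ _]; apply=> // x xa; apply/vin_vrank; exact: rank_trans an xa.
Qed.

Lemma star_vrank_mono m n v : (m <= n)%N ->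
  vin v (star (vrank m : stdV U)) -> vin v (star (vrank n : stdV U)).
Proof.
move=> mn.
have := @transfer _ U (BAll 9 7 (BIn 9 8)) (env [:: vrank m; vrank n]).
move=> -[+ _]; apply=> // x /vin_vrank xm; apply/vin_vrank; exact: rank_mono xm.
Qed.

Lemma star_vrank_trans n u v : vin u (star (vrank n : stdV U)) -> vin v u ->
  vin v (star (vrank n : stdV U)).
Proof.
have := @transfer _ U (BAll 8 7 (BAll 9 8 (BIn 9 7))) (env [:: vrank n]).
move=> [H _] us vu; apply: (H _ u us v vu).
by move=> x /vin_vrank xn y yx; apply/vin_vrank; exact: rank_trans yx.
Qed.

Lemma internal_vin u v : internal u -> vin v u -> internal v.
Proof.
move=> /internalP[n un] vu; apply/internalP; exists n.
exact: star_vrank_trans vu.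
Qed.

Lemma internal_vempty : internal (vempty : nsV U).
Proof.
suff <- : star (vempty : stdV U) = vempty.
  exists (vrank 1); apply/star_vin/vin_vrank.
  by apply: rank_setof; exact: sub0set.
apply: vin_ext; [exact/star_is_set/is_set_vempty|exact: is_set_vempty|].
have := @transfer _ U (BAll 8 7 (BNot (BEq 8 8))) (env [:: vempty]).
move=> -[+ _] z; rewrite /= => h; split=> [zv|/vin_vempty//].
by case: (h _ z zv) => // x /vin_vempty.
Qed.

Lemma internal_adjoin u v :
  is_set u -> internal u -> internal v -> internal (vunion u (sing v)).
Proof.
move=> us /internalP[m um] /internalP[n vn].
pose k := maxn m n.
have uk : vin u (star (vrank k : stdV U)).
  by apply: star_vrank_mono um; exact: leq_maxl.
have vk : vin v (star (vrank k : stdV U)).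
  by apply: star_vrank_mono vn; exact: leq_maxr.
(* The formula says that adjoining one element of rank [k] to another gives a set of rank [k.+1];
   extensionality then identifies the transferred witness [c]. *)
have := @transfer _ U (BAll 10 7 (BAll 11 7 (BEx 12 8 (BAnd (BIn 11 12)
  (BAnd (BAll 13 10 (BIn 13 12)) (BAll 13 12 (BOr (BIn 13 10) (BEq 13 11))))))))
  (env [:: vrank k; vrank k.+1]).
move=> -[+ _] => /(_ _ u uk v vk)[|c ck /= [vc [uc cu]]].
  move=> x /vin_vrank xk y /vin_vrank yk; exists (vunion x (sing y)).
    apply/vin_vrank; apply: rank_setof => z [|/vin_sing->//]; exact: rank_trans.
  split; first by apply/vin_vunion; right; apply/vin_sing.
  split=> z zx; first by apply/vin_vunion; left.
  by case/vin_vunion: zx => [|/vin_sing]; [left|right].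
suff -> : vunion u (sing v) = c by exists (vrank k.+1).
apply: vin_ext; [exact: is_set_vunion|exact: is_set_vin vc|] => z.
rewrite vin_vunion vin_sing; split=> [[/uc//|->//]|/cu//].
Qed.

(** * Finite induction and its transfer *)

(** In the standard universe [f] labels [X] injectively by naturals up to [m], so ordinary induction
    on the labels adjoins the points one at a time. *)
Lemma finite_induction n :
  hyperfinite_induction (vrank n) (setof (range (fun n : nat => real U n%:R)))
    (rel_graph (@real R U) (fun a b => a <= b)) (op_graph (@real R U) *%R)
    (real U 1).
Proof.
have natP z : vin z (setof (range (fun n : nat => real U n%:R))) <->
    exists k : nat, z = real U k%:R.
  rewrite (@vin_setof _ _ 0) => [|_ [k _ <-]].
    by split=> [[k _ <-]|[k ->]]; exists k.
  by exists (real_base U k%:R).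
move=> X XW f _ p _ g _ _ /natP[m ->] al _ hf finj [A0 A0W [sA0 A0e]] step.
pose W : stdV U := vrank n.
pose L : stdV U := rel_graph (@real R U) (fun a b => a <= b).
pose M := op_graph (@real R U) *%R.
(* Build the set of the x in X whose label is less than k, by induction on k. *)
have H k : exists2 A, vin A W & scaled W L M (real U 1) p g al A /\
   forall t, vin t A <-> vin t X /\
     exists2 j : nat, (j < k)%N & vin (opair t (real U j%:R)) f.
  elim: k => [|k [A AW [sA Ak]]].
    by exists A0 => //; split=> // t; split=> [/A0e|[_ [j]]].
  (* By injectivity at most one point has label [k]: it is adjoined if it exists, and otherwise [A]
     already serves for [k.+1]. *)
  have [[x [xX xk]]|nx] :=
      pselect (exists x, vin x X /\ vin (opair x (real U k%:R)) f).
    have [B BW [sB [xB [AB BA]]]] := step A AW sA x xX.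
    exists B => //; split=> // t; split.
      case/BA => [/Ak[tX [j jk tj]]|->].
        by split=> //; exists j; first exact: ltnW.
      by split=> //; exists k.
    move=> [tX [j]]; rewrite ltnS leq_eqVlt => /orP[/eqP->|jk] tj.
      by rewrite (finj t tX x xX (real U k%:R)) //; apply/natP; exists k.
    by apply/AB/Ak; split=> //; exists j.
  exists A => //; split=> // t; split.
    by case/Ak=> tX [j jk tj]; split=> //; exists j; first exact: ltnW.
  move=> [tX [j]]; rewrite ltnS leq_eqVlt => /orP[/eqP->|jk] tj.
    by case: nx; exists t.
  by apply/Ak; split=> //; exists j.
(* Labels are at most [m], whereas [H] collects labels strictly below its argument. *)
have [A AW [sA Am]] := H m.+1.
exists A => //; split=> //; split=> t; first by case/Am.
move=> tX; apply/Am; split=> //.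
have [_ /natP[j ->] [tj]] := hf t tX.
move=> /vin_rel_graph[a [b [/real_inj<- /real_inj<-]]].
by rewrite ler_nat => jm; exists j.
Qed.

Lemma hyperfinite_induction_ns n :
  hyperfinite_induction (star (vrank n : stdV U))
    (star (setof (range (fun n : nat => real U n%:R))))
    (rel_graph (@hyp R U) (fun a b => a <= b)) (op_graph (@hyp R U) *%R)
    (hyp (std U 1)).
Proof.
(* All five parameters become images under [star], as transfer requires. *)
rewrite -star_le -star_mul -star_real.
pose e := (env [:: vrank n : stdV U; setof (range (fun n : nat => real U n%:R));
  rel_graph (@real R U) (fun a b => a <= b); op_graph (@real R U) *%R;
  real U 1]).
have /sat_hyperfinite_inductionF :
    hyperfinite_induction (e 7) (e 8) (e 9) (e 10) (e 11).
  exact: finite_induction.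
by move/transfer/sat_hyperfinite_inductionF.
Qed.

(** Transitivity is applied twice, through [{u, v}]. This places arguments and values of an internal
    function within the quantifier bound. *)
Lemma star_vrank_opair n u v : vin (opair u v) (star (vrank n : stdV U)) ->
  vin u (star (vrank n : stdV U)) /\ vin v (star (vrank n : stdV U)).
Proof.
move=> uv; have pair_in : vin (setof [set u; v]) (opair u v).
  by apply/vin_opair; right.
have := star_vrank_trans uv pair_in => /star_vrank_trans h.
by split; apply: h; apply/vin_pair; [left|right].
Qed.

(** * Internal subsets of infinitesimal measure *)

Lemma vin_graph_ipowerset (Omega : nsV U) (F : nsV U -> hyperreal U) u v :
  vin (opair u v) (graph (ipowerset Omega) (fun A => hyp (F A))) <->
  ipowerset Omega u /\ v = hyp (F u).
Proof.
have [n On] := rank_exhaust Omega.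
apply: (@vin_graph _ _ n.+1) => [x [xs _ xO]|x _]; last exact: rank_atom.
by right; split=> // z /xO; exact: rank_trans.
Qed.

(** The equation amounts to [(1 - alpha) * std U (St (P A)) = 0], that is, [St (P A) = 0]. The bound
    [P A <= 1] ensures that this is a true standard part and not the default value 0. *)
Lemma P_alpha_eq (P : nsV U -> hyperreal U) (alpha : hyperreal U) (A : nsV U) :
  alpha <> 1 -> 0 <= P A ->
  (P A <= 1 /\ P_alpha P alpha A = alpha * P A) <-> infclose (P A) 0.
Proof.
move=> a1 PA0; split=> [[PA1 e]|PA].
  have h : (1 - alpha) * std U (St (P A)) = 0 by move: e; rewrite /P_alpha; lra.
  have := @St_infclose (P A) 0 1; rewrite std0 std1 => /(_ PA0 PA1).
  move/eqP: h; rewrite mulf_eq0 => /orP[|/eqP-> //].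
  by rewrite subr_eq0 => /eqP e1; case: a1.
split; last by rewrite /P_alpha (@St_eq _ 0) std0 ?add0r ?subr0.
have := PA 1 ltr01; rewrite subr0 std1 ger0_norm //; exact: ltW.
Qed.

Lemma ipowerset_vempty (Omega : nsV U) : ipowerset Omega vempty.
Proof.
split; [exact: is_set_vempty|exact: internal_vempty|].
by move=> z /vin_vempty.
Qed.

Lemma ipowerset_adjoin (Omega A w : nsV U) : internal Omega ->
  ipowerset Omega A -> vin w Omega -> ipowerset Omega (vunion A (sing w)).
Proof.
move=> Oi [As Ai AO] wO; split; first exact: is_set_vunion.
  by apply: internal_adjoin => //; exact: internal_vin wO.
by move=> z /vin_vunion[/AO//|/vin_sing->].
Qed.

Lemma ipowerset_sing (Omega w : nsV U) : internal Omega -> vin w Omega ->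
  ipowerset Omega (sing w).
Proof.
move=> Oi wO; have := ipowerset_adjoin Oi (ipowerset_vempty Omega) wO.
suff -> : vunion vempty (sing w) = sing w by [].
apply: vin_ext; [exact: is_set_vunion|exact: is_set_sing|] => z.
by rewrite vin_vunion; split=> [[/vin_vempty|]//|]; right.
Qed.

(** The empty set is disjoint from itself, so additivity gives [P vempty = P vempty + P vempty]. *)
Lemma P_vempty (Omega : nsV U) (P : nsV U -> hyperreal U) :
  internal_probability Omega P -> P vempty = 0.
Proof.
move=> [_ _ _ Padd]; have e0 := ipowerset_vempty Omega.
have /(Padd _ _ e0 e0) : ext (vempty : nsV U) `&` ext vempty = set0.
  by apply/seteqP; split=> // z [/vin_vempty].
have -> : vunion (vempty : nsV U) vempty = vempty.
  apply: vin_ext; [exact: is_set_vunion|exact: is_set_vempty|] => z.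
  by rewrite vin_vunion; tauto.
lra.
Qed.

Lemma P_adjoin (Omega : nsV U) (P : nsV U -> hyperreal U) (A w : nsV U) :
  internal Omega -> internal_probability Omega P ->
  ipowerset Omega A -> vin w Omega ->
  infclose (P A) 0 -> infclose (P (sing w)) 0 ->
  infclose (P (vunion A (sing w))) 0.
Proof.
move=> Oi [_ _ _ Padd] hA wO PA Pw.
have [wA|wA] := pselect (vin w A).
  suff -> : vunion A (sing w) = A by [].
  case: (hA) => As _ _; apply: vin_ext; [exact: is_set_vunion|by []|] => z.
  by rewrite vin_vunion vin_sing; split=> [[//|->//]|]; left.
have /(Padd _ _ hA (ipowerset_sing Oi wO)) -> : ext A `&` ext (sing w) = set0.
  by apply/seteqP; split=> // z [zA /vin_sing zw]; apply: wA; rewrite -zw.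
by move: PA Pw; rewrite /infclose !subr0; exact: infinitesimalD.
Qed.

End Transfer.

(** * Externality of [P_alpha] *)

Theorem theorem1 (R : realType) (U : nonstandard_universe R) (Omega : nsV U)
  (P : nsV U -> hyperreal U) (alpha : hyperreal U)
  (hOmega : hyperfinite Omega)
  (hP : internal_probability Omega P)
  (hP0 : forall w : nsV U, vin w Omega -> infclose (P (sing w)) 0)
  (halpha0 : 0 < alpha)
  (halphafin : limited alpha)
  (halpha1 : alpha <> 1) :
  external_on Omega (P_alpha P alpha).
Proof.
move=> hG; have [Os Oi [N [F [hN hF Fi]]]] := hOmega.
have [Ffun Finj _] := hF.
have [Pi P_ge0 P1 _] := hP.
(* [alpha] is a parameter of the transferred formula, so it too must lie in the bounding set. *)
have ai : internal (hyp alpha).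
  exists (setof (range (@real R U))); rewrite star_reals.
  apply/(@vin_setof _ (nsV U) 0) => [_ [x _ <-]|]; last by exists alpha.
  by exists (hyp_base x).
pose D A := ipowerset Omega A /\ infclose (P A) 0.
have [n [OW FW PW GW aW]] : exists n, let W := star (vrank n : stdV U) in
    [/\ vin Omega W, vin (graph (ext Omega) F) W,
        vin (graph (ipowerset Omega) (fun A => hyp (P A))) W,
        vin (graph (ipowerset Omega) (fun A => hyp (P_alpha P alpha A))) W &
        vin (hyp alpha) W].
  move/internalP: Oi => [n1 h1]; move/internalP: Fi => [n2 h2].
  move/internalP: Pi => [n3 h3]; move/internalP: hG => [n4 h4].
  move/internalP: ai => [n5 h5].
  exists (n1 + n2 + n3 + n4 + n5)%N; split;
    [move: h1|move: h2|move: h3|move: h4|move: h5]; apply: star_vrank_mono; lia.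
(* With the graphs of [P] and [P_alpha] as parameters, the bounded formula defines exactly [D]. The
   graph of [P_alpha] is an admissible parameter because of [hG]. *)
have scaledE A : scaled (star (vrank n : stdV U))
    (rel_graph (@hyp R U) (fun a b => a <= b)) (op_graph (@hyp R U) *%R)
    (hyp (std U 1)) (graph (ipowerset Omega) (fun A => hyp (P A)))
    (graph (ipowerset Omega) (fun A => hyp (P_alpha P alpha A)))
    (hyp alpha) A <-> D A.
  split.
    move=> [r _ [s _ [[/vin_graph_ipowerset[hA ->] PA1]]]].
    move=> [/vin_graph_ipowerset[_ ->] e]; split=> //.
    apply/(P_alpha_eq halpha1 (P_ge0 _ hA)); split.
      move/vin_rel_graph: PA1 => [a [b [/hyp_inj-> /hyp_inj<-]]].
      by rewrite std1.
    by move/vin_op_graph: e => [a [b [/hyp_inj-> /hyp_inj-> /hyp_inj->]]].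
  move=> [hA /(P_alpha_eq halpha1 (P_ge0 _ hA))[PA1 e]].
  have hp : vin (opair A (hyp (P A)))
      (graph (ipowerset Omega) (fun A => hyp (P A))).
    exact/vin_graph_ipowerset.
  have hg : vin (opair A (hyp (P_alpha P alpha A)))
      (graph (ipowerset Omega) (fun A => hyp (P_alpha P alpha A))).
    exact/vin_graph_ipowerset.
  have [_ rW] := star_vrank_opair (star_vrank_trans PW hp).
  have [_ sW] := star_vrank_opair (star_vrank_trans GW hg).
  exists (hyp (P A)) => //; exists (hyp (P_alpha P alpha A)) => //.
  split; split=> //.
    by apply/vin_rel_graph; exists (P A), (std U 1); rewrite std1.
  by apply/vin_op_graph; exists alpha, (P A); rewrite e.
(* [A] is the first coordinate of a pair in the graph of [P], which lies in the bounding set. *)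
have DW A : D A -> vin A (star (vrank n : stdV U)).
  move=> [hA _]; apply: (proj1 (star_vrank_opair (v := hyp (P A)) _)).
  by apply: star_vrank_trans PW _; apply/vin_graph_ipowerset.
have graphF x y : vin (opair x y) (graph (ext Omega) F) <->
    vin x Omega /\ y = F x.
  have [m Om] := rank_exhaust Omega.
  apply: (@vin_graph _ _ m) => [z|z zO]; first exact: rank_trans.
  by have [k _ <-] := Ffun _ zO; exact: rank_atom.
(* The four premises left are that [F] labels [Omega] up to [N], that it is injective, the empty
   set, and the adjunction of a point. *)
have [||||A _ [/scaledE[[As Ai _] hA] [AO OA]]] :=
    @hyperfinite_induction_ns R U n Omega OW _ FW _ PW _ GW
      (hyp N) hN (hyp alpha) aW.
- move=> x xO; have [k [kN /andP[_ kle]] kF] := Ffun _ xO.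
  exists (hyp k) => //; split; first by apply/graphF.
  by apply/vin_rel_graph; exists k, N.
- move=> x xO y yO k _ [/graphF[_ ->] /graphF[_ e]].
  by apply: Finj => //; apply/mem_set.
- have D0 : D vempty.
    split; first exact: ipowerset_vempty.
    by rewrite (P_vempty hP) => r r0; rewrite subrr normr0 -std0 std_lt.
  exists vempty; first exact: DW.
  by split; [exact/scaledE|move=> t /vin_vempty].
- move=> A _ /scaledE[hA PA] w wO.
  have DB : D (vunion A (sing w)).
    split; first exact: ipowerset_adjoin.
    by apply: P_adjoin hP _ _ _ _ => //; exact: hP0.
  exists (vunion A (sing w)); first exact: DW.
  split; first exact/scaledE.
  split; first by apply/vin_vunion; right; apply/vin_sing.
  split=> t; first by move=> tA; apply/vin_vunion; left.
  by move=> /vin_vunion[|/vin_sing]; [left|right].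
(* The induction has reached all of [Omega], so [P Omega = 1] would be infinitesimal. *)
have AE : A = Omega by apply: vin_ext => // z; split=> [/AO|/OA].
move: hA; rewrite AE P1 -std0 -std1 => /infclose_std/eqP.
by rewrite oner_eq0.
Qed.
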